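(* Let $u:\Omega\to\mathbb{C}$ be a measurable function. The multiplication operator $M_u$, $M_uf=u\cdot f$, is bounded on the weighted Orlicz space $L^\phi_\omega(\Omega)$ if and only if $u\in L^\infty(\mu)$. Moreover, $\|M_u\|=\|u\|_\infty$.
   Context: $(\Omega,\Sigma,\mu)$ is a $\sigma$-finite complete measure space. $\tau:\Omega\to\Omega$ is a measurable transformation ($\tau^{-1}(A)\in\Sigma$ for all $A\in\Sigma$) which is nonsingular ($\mu(\tau^{-1}(A))=0$ whenever $\mu(A)=0$). The weight $\omega=\frac{d\mu\circ\tau^{-1}}{d\mu}$ is the Radon-Nikodym derivative of $\mu\circ\tau^{-1}$ with respect to $\mu$: a non-negative locally integrable function on $\Omega$ with $\mu(\tau^{-1}(A))=\int_A\omega\,d\mu$ for all $A\in\Sigma$. An Orlicz function is a continuous convex function $\phi:[0,\infty)\to[0,\infty)$ with $\phi(x)=0$ if and only if $x=0$, $\lim_{x\to0}\phi(x)/x=0$ and $\lim_{x\to\infty}\phi(x)/x=\infty$; $\phi$ is such a function. $L^0(\Omega)$ is the linear space of ($\mu$-a.e. equivalence classes of) $\Sigma$-measurable complex-valued functions on $\Omega$. The weighted Orlicz space is $L^\phi_\omega(\Omega)=\{f\in L^0(\Omega):\int_\Omega\phi(\alpha|f|)\,\omega\,d\mu<\infty\text{ for some }\alpha>0\}$, with norm $\|f\|_{\phi,\omega}=\inf\{k>0:\int_\Omega\phi(|f|/k)\,\omega\,d\mu\le1\}$.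
   Formalization: Assumes that the weighted Orlicz norm is a genuine norm modulo μ-a.e. equality (‖f‖=0 implies f=0 μ-a.e., i.e. ω>0 a.e.); if ω vanishes on a set Z of positive measure the claim fails, e.g. u=1_Z gives ‖M_u‖=0 but ‖u‖_∞=1. *)

(* Defs.v *)
From HB Require Import structures.
From mathcomp Require Import all_boot all_order all_algebra.
From mathcomp Require Import all_classical all_reals all_analysis.
From mathcomp Require Import complex.

Set Implicit Arguments.
Unset Strict Implicit.
Unset Printing Implicit Defensive.

Import Order.TTheory GRing.Theory Num.Theory.
Import numFieldTopology.Exports numFieldNormedType.Exports.

Local Open Scope classical_set_scope.
Local Open Scope ring_scope.

(* Only the values on [0, +oo[ matter: the negative half-line is never
   constrained nor used. *)
Definition orlicz_function (R : realType) (phi : R -> R) : Prop :=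
  [/\ forall x : R, 0 <= x -> 0 <= phi x,
      {within `[0, +oo[, continuous phi},
      @convex_function R R^o `[0, +oo[ phi,
      forall x : R, 0 <= x -> (phi x = 0 <-> x = 0)
    & (phi x / x @[x --> 0^'+] --> 0) /\ (phi x / x @[x --> +oo] --> +oo)].

(* The norm of R[i] takes its values in R[i]; this is the same number in R. *)
Definition cabs (R : realType) (z : R[i]) : R := complex.Re `|z|.

(* Elements of L^0 are represented by functions; every notion below is
   invariant under mu-a.e. equality. *)
Definition cmeasurable d (T : measurableType d) (R : realType)
    (f : T -> R[i]) : Prop :=
  measurable_fun setT (fun x => complex.Re (f x)) /\
  measurable_fun setT (fun x => complex.Im (f x)).

Definition nonsingular d (T : measurableType d) (R : realType)
    (mu : set T -> \bar R) (tau : T -> T) : Prop :=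
  measurable_fun setT tau /\
  forall A, measurable A -> mu A = 0%E -> mu (tau @^-1` A) = 0%E.

(* Unlike [locally_integrable] of the library, which concerns the Lebesgue
   measure, local integrability on an abstract measure space means
   integrability over the sets of finite measure. *)
Definition locally_integrable_fun d (T : measurableType d) (R : realType)
    (mu : {measure set T -> \bar R}) (w : T -> R) : Prop :=
  measurable_fun setT w /\
  forall A, measurable A -> (mu A < +oo)%E -> mu.-integrable A (EFin \o w).

(* The Radon-Nikodym derivative of the library requires a finite measure, and
   [pushforward mu tau] need not be one. *)
Definition is_RN_pushforward d (T : measurableType d) (R : realType)
    (mu : {measure set T -> \bar R}) (tau : T -> T) (w : T -> R) : Prop :=
  [/\ forall x, 0 <= w x,
      locally_integrable_fun mu w
    & forall A, measurable A ->
        pushforward mu tau A = (\int[mu]_(x in A) (w x)%:E)%E].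

Section weighted_orlicz_space.
Context d (T : measurableType d) (R : realType).
Variables (mu : {measure set T -> \bar R}) (phi : R -> R) (w : T -> R).

Definition orlicz_space : set (T -> R[i]) :=
  [set f | cmeasurable f /\
    exists2 a : R, 0 < a &
      (\int[mu]_x (phi (a * cabs (f x)) * w x)%:E < +oo)%E].

(* An infimum in \bar R, hence +oo when no k is admissible. *)
Definition orlicz_norm (f : T -> R[i]) : \bar R :=
  ereal_inf [set k%:E | k in
    [set k : R | 0 < k /\
      (\int[mu]_x (phi (cabs (f x) / k) * w x)%:E <= 1)%E]].

(* The only norm axiom that can fail for [orlicz_norm] on classes modulo
   mu-a.e. equality: it fails when w vanishes on a set of positive measure. *)
Definition orlicz_norm_definite : Prop :=
  forall f, orlicz_space f -> orlicz_norm f = 0%E ->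
    \forall x \ae mu, f x = 0.

Definition bounded_operator (M : (T -> R[i]) -> T -> R[i]) : Prop :=
  (forall f, orlicz_space f -> orlicz_space (M f)) /\
  exists2 C : R, 0 <= C &
    forall f, orlicz_space f ->
      (orlicz_norm (M f) <= C%:E * orlicz_norm f)%E.

Definition operator_norm (M : (T -> R[i]) -> T -> R[i]) : \bar R :=
  ereal_sup [set orlicz_norm (M f) | f in
    [set f | orlicz_space f /\ (orlicz_norm f <= 1)%E]].

End weighted_orlicz_space.

Definition mult_operator (T : Type) (R : realType) (u : T -> R[i])
    (f : T -> R[i]) : T -> R[i] := fun x => u x * f x.

Definition Linfty_norm d (T : measurableType d) (R : realType)
    (mu : {measure set T -> \bar R}) (u : T -> R[i]) : \bar R :=
  Lnorm mu +oo%E (fun x => (cabs (u x))%:E).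

Definition Linfty d (T : measurableType d) (R : realType)
    (mu : {measure set T -> \bar R}) : set (T -> R[i]) :=
  [set u | cmeasurable u /\ (Linfty_norm mu u < +oo)%E].

(* Main.v *)
(* For the upper bound, |u f| <= C |f| a.e. as soon as C > 0 is an a.e. bound of
   |u|, and the Luxemburg norm is monotone and positively homogeneous.
   For the lower bound, the definiteness of the norm forces w > 0 a.e. (test it
   on the indicator of {w = 0}).  If {|u| > c} is not null, then by
   sigma-finiteness it contains a set A of finite positive measure, so that
   0 < \int_A w < +oo; if phi a = 1 / \int_A w, then a * 1_A has norm 1, and
   |u| > c on A gives ||u f|| >= c ||f|| = c for f = a * 1_A. *)

Require Import Defs.
From mathcomp Require Import all_boot all_order all_algebra.
From mathcomp Require Import all_classical all_reals all_analysis.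
From mathcomp Require Import complex.
From mathcomp Require Import measurable_realfun ess_sup_inf.

Import Order.TTheory GRing.Theory Num.Theory.
Import numFieldTopology.Exports numFieldNormedType.Exports.

Local Open Scope classical_set_scope.
Local Open Scope ring_scope.

(** * The real-valued modulus of complex numbers *)

Section cabs.
Context {R : realType}.
Implicit Types z : R[i].

Lemma cabsE z : cabs z = Num.sqrt (complex.Re z ^+ 2 + complex.Im z ^+ 2).
Proof. by rewrite /cabs normc_def. Qed.

Lemma cabs_ge0 z : 0 <= cabs z.
Proof. by rewrite cabsE sqrtr_ge0. Qed.

Lemma cabsM z1 z2 : cabs (z1 * z2) = cabs z1 * cabs z2.
Proof. by rewrite /cabs normrM !normc_def -rmorphM. Qed.

Lemma cabs_real (x : R) : cabs x%:C%C = `|x|.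
Proof. by rewrite cabsE /= expr0n /= addr0 sqrtr_sqr. Qed.

End cabs.

(** * Measurability of complex-valued functions *)

Section cmeasurable.
Context {d : measure_display} {T : measurableType d} {R : realType}.
Implicit Types f g : T -> R[i].

Lemma measurable_cabs {f} : cmeasurable f ->
  measurable_fun setT (fun x => cabs (f x)).
Proof.
move=> [mRe mIm]; under eq_fun do rewrite cabsE.
apply: (@measurableT_comp _ _ _ _ _ _ (@Num.sqrt R)).
  by apply: continuous_measurable_fun; exact: sqrt_continuous.
by apply: measurable_funD; exact: measurable_funX.
Qed.

Lemma cmeasurable_mult {f g} : cmeasurable f -> cmeasurable g ->
  cmeasurable (mult_operator f g).
Proof.
move=> [fr fi] [gr gi]; split.
- rewrite (_ : (fun _ => _) = fun x =>
    complex.Re (f x) * complex.Re (g x) - complex.Im (f x) * complex.Im (g x)).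
    by apply: measurable_funB; exact: measurable_funM.
  by apply/funext => x; rewrite /mult_operator; case: (f x) (g x) => ? ? [].
- rewrite (_ : (fun _ => _) = fun x =>
    complex.Re (f x) * complex.Im (g x) + complex.Im (f x) * complex.Re (g x)).
    by apply: measurable_funD; exact: measurable_funM.
  by apply/funext => x; rewrite /mult_operator; case: (f x) (g x) => ? ? [].
Qed.

Lemma cmeasurable_real {h : T -> R} : measurable_fun setT h ->
  cmeasurable (fun x => (h x)%:C%C).
Proof. by move=> mh; split => //=; exact: measurable_cst. Qed.

End cmeasurable.

(** * Monotonicity, surjectivity and measurability of an Orlicz function *)

Section orlicz_function_theory.
Context {R : realType} {phi : R -> R}.
Hypothesis phi_orlicz : orlicz_function phi.

Lemma orlicz_ge0 {x : R} : 0 <= x -> 0 <= phi x.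
Proof. by case: phi_orlicz => + _ _ _ _; exact. Qed.

Lemma orlicz0 : phi 0 = 0.
Proof. by case: phi_orlicz => _ _ _ /(_ _ (lexx 0))[_ ->]. Qed.

Lemma orlicz_gt0 {x : R} : 0 < x -> 0 < phi x.
Proof.
move=> x0; rewrite lt_neqAle orlicz_ge0 ?ltW// andbT eq_sym; apply/eqP.
case: phi_orlicz => _ _ _ /(_ _ (ltW x0))[+ _] _ phix0 => /(_ phix0)/eqP.
by rewrite gt_eqF.
Qed.

(** Convexity between [x] and [0], where the second endpoint contributes nothing because
    [phi 0 = 0]. *)
Lemma orlicz_scale {t x : R} : 0 <= t <= 1 -> 0 <= x ->
  phi (t * x) <= t * phi x.
Proof.
move=> t01 x0; case: (phi_orlicz) => _ _ cvx _ _.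
have : phi (t * x + unstable.onem t * 0) <= t * phi x + unstable.onem t * phi 0.
  by apply: (cvx (Itv01 (proj1 (andP t01)) (proj2 (andP t01))) x 0);
    rewrite inE/= in_itv/= ?x0 ?lexx.
by rewrite orlicz0 !mulr0 !addr0.
Qed.

(** Monotonicity comes from convexity alone: [x] is the multiple [x / y] of [y], so scaling gives
    [phi x <= (x / y) * phi y], and this is below [phi y] because [phi y > 0]. *)
Lemma orlicz_lt {x y : R} : 0 <= x -> x < y -> phi x < phi y.
Proof.
move=> x0 xy; have y0 : 0 < y by exact: le_lt_trans xy.
have -> : x = x / y * y by rewrite mulfVK// gt_eqF.
apply: (@le_lt_trans _ _ (x / y * phi y)).
  apply: orlicz_scale; last exact: ltW.
  by rewrite divr_ge0 ?(ltW y0)//= ler_pdivrMr// mul1r ltW.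
by rewrite gtr_pMl ?orlicz_gt0// ltr_pdivrMr// mul1r.
Qed.

Lemma orlicz_le {x y : R} : 0 <= x -> x <= y -> phi x <= phi y.
Proof.
by move=> x0; rewrite le_eqVlt => /predU1P[->//|xy]; exact/ltW/orlicz_lt.
Qed.

(** Intermediate value theorem on [[0, b]]: [phi] starts at [0], and its superlinear growth supplies
    a [b] with [phi b > v]. *)
Lemma orlicz_onto {v : R} : 0 < v -> exists2 a, 0 < a & phi a = v.
Proof.
move=> v0; case: (phi_orlicz) => _ cont _ _ [_ /cvgryPgt/(_ v) lim].
(* Asking for [b >= 1] makes [phi b / b <= phi b], so the bound on the quotient passes to
   [phi b]. *)
have [b [b1 vb]] : exists b : R, 1 <= b /\ v < phi b / b.
  have : \forall b \near +oo, 1 <= b /\ v < phi b / b.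
    by near=> b; split; near: b; [exact: nbhs_pinfty_ge|exact: lim].
  by move=> /filter_ex.
have b0 : 0 < b by exact: lt_le_trans b1.
have vb' : v < phi b.
  apply: (lt_le_trans vb); rewrite ler_pdivrMr// ler_peMr//.
  exact/ltW/orlicz_gt0.
have cont0b : {within `[0, b], continuous phi}.
  apply: continuous_subspaceW cont => x /=; rewrite !in_itv/=.
  by move=> /andP[->].
have [|a + av] := IVT (ltW b0) cont0b (v := v).
  by rewrite orlicz0 ge_min le_max (ltW v0) (ltW vb') orbT.
rewrite in_itv/= => /andP[a0 _]; exists a => //.
rewrite lt_neqAle a0 andbT; apply/eqP => a0E.
by move: v0; rewrite -av -a0E orlicz0 ltxx.
Unshelve. all: by end_near. Qed.

Lemma measurable_orlicz : measurable_fun (`[0, +oo[ : set R) phi.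
Proof.
case: phi_orlicz => _ cont _ _ _.
by apply: subspace_continuous_measurable_fun cont; exact: measurable_itv.
Qed.

End orlicz_function_theory.

(** * The modular, the Luxemburg norm and multiplication by a bounded function *)

Section orlicz_norm_theory.
Context {d : measure_display} {T : measurableType d} {R : realType}.
Variables (mu : {measure set T -> \bar R}) (phi : R -> R) (w : T -> R).
Hypotheses (phi_orlicz : orlicz_function phi) (w_ge0 : forall x, 0 <= w x).
Hypothesis w_meas : measurable_fun setT w.
Implicit Types f g u : T -> R[i].

Lemma modular_ge0 (a : R) f x : 0 <= a ->
  (0 <= (phi (a * cabs (f x)) * w x)%:E)%E.
Proof.
move=> a0; rewrite lee_fin mulr_ge0// (orlicz_ge0 phi_orlicz)//.
by rewrite mulr_ge0// cabs_ge0.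
Qed.

(** Since [phi] is controlled only on the closed half-line, the composition goes through that set,
    which contains the range of [a * cabs (f x)]. *)
Lemma measurable_modular (a : R) f : 0 <= a -> cmeasurable f ->
  measurable_fun setT (fun x => (phi (a * cabs (f x)) * w x)%:E).
Proof.
move=> a0 mf; apply/measurable_EFinP; apply: measurable_funM => //.
apply: (@measurable_comp _ _ _ _ _ _ (`[0, +oo[ : set R) phi).
- exact: measurable_itv.
- by move=> _ [x _ <-]/=; rewrite in_itv/= andbT mulr_ge0// cabs_ge0.
- exact: measurable_orlicz.
- by apply: measurable_funM; [exact: measurable_cst|exact: measurable_cabs].
Qed.

(** The two scalars are independent so that a bound [|f| <= C |g|] can be absorbed into them, both
    for membership in the space and for the norm. *)
Lemma le_modular (a b : R) f g : 0 <= a -> 0 <= b ->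
  cmeasurable f -> cmeasurable g ->
  (\forall x \ae mu, a * cabs (f x) <= b * cabs (g x)) ->
  (\int[mu]_x (phi (a * cabs (f x)) * w x)%:E <=
   \int[mu]_x (phi (b * cabs (g x)) * w x)%:E)%E.
Proof.
move=> a0 b0 mf mg fg; apply: ae_ge0_le_integral => //.
- by move=> x _; exact: modular_ge0.
- exact: measurable_modular.
- by move=> x _; exact: modular_ge0.
- exact: measurable_modular.
apply: filterS fg => x fgx _; rewrite lee_fin ler_wpM2r// (orlicz_le phi_orlicz)//.
by rewrite mulr_ge0// cabs_ge0.
Qed.

Lemma orlicz_norm_ge0 f : (0 <= orlicz_norm mu phi w f)%E.
Proof. by apply/ereal_infP => _ [k [k0 _] <-]; rewrite lee_fin ltW. Qed.

Lemma orlicz_space_le (C : R) f g : 0 < C -> cmeasurable f ->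
  orlicz_space mu phi w g ->
  (\forall x \ae mu, cabs (f x) <= C * cabs (g x)) ->
  orlicz_space mu phi w f.
Proof.
move=> C0 mf [mg [a a0 fin_g]] fg; split=> //; exists (a / C).
  exact: divr_gt0.
apply: le_lt_trans fin_g; apply: le_modular => //.
- by rewrite divr_ge0// ltW.
- exact: ltW.
- apply: filterS fg => x fgx.
  by rewrite -mulrA ler_pM2l// ler_pdivrMl.
Qed.

Lemma orlicz_norm_le (C : R) f g : 0 < C -> cmeasurable f -> cmeasurable g ->
  (\forall x \ae mu, cabs (f x) <= C * cabs (g x)) ->
  (orlicz_norm mu phi w f <= C%:E * orlicz_norm mu phi w g)%E.
Proof.
move=> C0 mf mg fg; rewrite -lee_pdivrMl//.
apply/ereal_infP => _ [k [k0 kg] <-]; rewrite lee_pdivrMl// -EFinM.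
(* If [k] is admissible for [g], then [C * k] is admissible for [f], because
   [|f| / (C k) <= |g| / k] almost everywhere. *)
apply: ereal_inf_lbound; exists (C * k) => //; split; first exact: mulr_gt0.
apply: le_trans kg.
under eq_integral do rewrite [_ / _]mulrC.
under [leRHS]eq_integral do rewrite [_ / _]mulrC.
apply: le_modular => //.
- by rewrite invr_ge0 mulr_ge0// ltW.
- by rewrite invr_ge0 ltW.
- apply: filterS fg => x fgx; rewrite invfM mulrAC [leLHS]mulrC ler_pM2l ?invr_gt0//.
  by rewrite ler_pdivrMl.
Qed.

(** On [A] the factor in [phi] is constant, and off [A] the integrand vanishes because
    [phi 0 = 0]. *)
Lemma integral_modular_indic (A : set T) (a k : R) : measurable A ->
  0 <= a -> 0 < k ->
  (\int[mu]_x (phi (cabs (a * \1_A x)%:C%C / k) * w x)%:E =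
   (phi (a / k))%:E * \int[mu]_(x in A) (w x)%:E)%E.
Proof.
move=> mA a0 k0; rewrite -ge0_integralZl//.
- rewrite [RHS]integral_mkcond; apply: eq_integral => x _.
  rewrite cabs_real patchE indicE; case: (x \in A).
    by rewrite mulr1 ger0_norm.
  by rewrite mulr0 normr0 mul0r (orlicz0 phi_orlicz) mul0r.
- by apply/measurable_EFinP; exact: measurable_funTS.
- by move=> x _; rewrite lee_fin.
- by rewrite lee_fin (orlicz_ge0 phi_orlicz)// divr_ge0// ltW.
Qed.

Lemma cmeasurable_indic (A : set T) (a : R) : measurable A ->
  cmeasurable (fun x => (a * \1_A x)%:C%C).
Proof.
move=> mA; apply: cmeasurable_real.
by apply: measurable_funM => //; exact: measurable_cst.
Qed.

Lemma orlicz_space_indic (A : set T) (a : R) : measurable A -> 0 <= a ->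
  (\int[mu]_(x in A) (w x)%:E < +oo)%E ->
  orlicz_space mu phi w (fun x => (a * \1_A x)%:C%C).
Proof.
move=> mA a0 fin_w; split; first exact: cmeasurable_indic.
exists 1 => //; under eq_integral do rewrite mul1r -[cabs _]divr1.
rewrite integral_modular_indic// lte_mul_pinfty//.
by rewrite lee_fin (orlicz_ge0 phi_orlicz)// divr1.
Qed.

Lemma orlicz_norm_indic1 (A : set T) : measurable A ->
  (0 < \int[mu]_(x in A) (w x)%:E < +oo)%E ->
  exists2 a : R, 0 < a &
    orlicz_norm mu phi w (fun x => (a * \1_A x)%:C%C) = 1%E.
Proof.
move=> mA /andP[wA0 wAy].
have wA_fin : (\int[mu]_(x in A) (w x)%:E)%E \is a fin_num.
  by rewrite ge0_fin_numE// ltW.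
have [m wAE] : exists m, (\int[mu]_(x in A) (w x)%:E = m%:E)%E.
  by exists (fine (\int[mu]_(x in A) (w x)%:E)%E); rewrite fineK.
rewrite wAE lte_fin in wA0.
have [|a a0 phia] := orlicz_onto phi_orlicz (v := m^-1); first by rewrite invr_gt0.
exists a => //; apply/eqP; rewrite eq_le; apply/andP; split.
  (* By the choice of [a], the modular at [k = 1] is exactly 1. *)
  apply: ereal_inf_lbound; exists 1 => //; split => //.
  rewrite integral_modular_indic ?(ltW a0)// wAE divr1 phia -EFinM.
  by rewrite mulVf// gt_eqF.
(* An admissible [k < 1] would give [phi (a / k) <= phi a] with [a < a / k], against strict
   monotonicity. *)
apply/ereal_infP => _ [k [k0 +] <-].
rewrite integral_modular_indic ?(ltW a0)// wAE -EFinM !lee_fin.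
rewrite -ler_pdivlMr// mul1r -phia => phi_le; rewrite leNgt; apply/negP => k1.
move: phi_le; rewrite leNgt (orlicz_lt phi_orlicz) ?(ltW a0)//.
by rewrite ltr_pdivlMr// gtr_pMr.
Qed.

Lemma operator_norm_ub u f : orlicz_space mu phi w f ->
  (orlicz_norm mu phi w f <= 1)%E ->
  (orlicz_norm mu phi w (mult_operator u f) <=
   operator_norm mu phi w (mult_operator u))%E.
Proof. by move=> fL f1; apply: ereal_sup_ubound; exists f. Qed.

Lemma mult_operator_le (C : R) u f : 0 < C -> cmeasurable u ->
  (\forall x \ae mu, cabs (u x) <= C) -> orlicz_space mu phi w f ->
  orlicz_space mu phi w (mult_operator u f) /\
  (orlicz_norm mu phi w (mult_operator u f) <= C%:E * orlicz_norm mu phi w f)%E.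
Proof.
move=> C0 um uC fL; have mf : cmeasurable f by case: fL.
have muf := cmeasurable_mult um mf.
have ufC : \forall x \ae mu, cabs (mult_operator u f x) <= C * cabs (f x).
  by apply: filterS uC => x uxC; rewrite cabsM ler_wpM2r// cabs_ge0.
by split; [exact: orlicz_space_le fL ufC|exact: orlicz_norm_le].
Qed.

Lemma operator_norm_le (C : R) u : 0 < C -> cmeasurable u ->
  (\forall x \ae mu, cabs (u x) <= C) ->
  (operator_norm mu phi w (mult_operator u) <= C%:E)%E.
Proof.
move=> C0 um uC; apply/ereal_supP => _ [f [fL f1] <-].
have [_ /le_trans->//] := mult_operator_le _ _ _ C0 um uC fL.
by rewrite -[leRHS]mule1 lee_wpmul2l// lee_fin ltW.
Qed.

(** A supremum in the extended reals could be [-oo] over an empty set; the zero function, written as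
    a multiple of an indicator, shows that the unit ball is inhabited. *)
Lemma operator_norm_ge0 u : (0 <= operator_norm mu phi w (mult_operator u))%E.
Proof.
pose f0 : T -> R[i] := fun x => (0 * \1_(set0 : set T) x)%:C%C.
have f0L : orlicz_space mu phi w f0.
  by apply: orlicz_space_indic => //; rewrite integral_set0.
apply: le_trans (operator_norm_ub u f0 f0L _); first exact: orlicz_norm_ge0.
apply: ereal_inf_lbound; exists 1 => //; split => //.
by rewrite integral_modular_indic// integral_set0 mule0.
Qed.

Lemma bounded_operator_norm u :
  bounded_operator mu phi w (mult_operator u) ->
  (operator_norm mu phi w (mult_operator u) < +oo)%E.
Proof.
move=> [_ [C C0 uC]]; apply: (@le_lt_trans _ _ C%:E); last exact: ltry.
apply/ereal_supP => _ [f [fL f1] <-]; apply: (le_trans (uC f fL)).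
by rewrite -[leRHS]mule1 lee_wpmul2l// lee_fin.
Qed.

Lemma weight_gt0_ae : orlicz_norm_definite mu phi w ->
  \forall x \ae mu, 0 < w x.
Proof.
move=> definite; pose Z := w @^-1` [set 0].
have mZ : measurable Z by rewrite -[Z]setTI; exact: w_meas.
have wZ : (\int[mu]_(x in Z) (w x)%:E = 0)%E.
  by apply: integral0_eq => x; rewrite /Z/= => ->.
pose f : T -> R[i] := fun x => (1 * \1_Z x)%:C%C.
have f0 : (orlicz_norm mu phi w f = 0)%E.
  apply/eqP; rewrite eq_le orlicz_norm_ge0 andbT.
  (* Every [e > 0] is admissible, since the modular of [f] is a multiple of the integral of [w] over
     [Z], which is 0. *)
  apply/lee_addgt0Pr => e e0; rewrite add0e.
  apply: ereal_inf_lbound; exists e => //; split => //.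
  by rewrite integral_modular_indic// wZ mule0.
have fL : orlicz_space mu phi w f by apply: orlicz_space_indic; rewrite ?wZ.
apply: filterS (definite f fL f0) => x.
rewrite /f => -[]; rewrite mul1r indicE => Zx.
rewrite lt_neqAle w_ge0 andbT; apply/eqP => wx0; move: Zx.
by rewrite mem_set//= => /eqP; rewrite oner_eq0.
Qed.

End orlicz_norm_theory.

(** * The essential supremum norm *)

Section Linfty_norm_theory.
Context {d : measure_display} {T : measurableType d} {R : realType}.
Variable mu : {measure set T -> \bar R}.
Implicit Type u : T -> R[i].

(** [Lnorm] at exponent [+oo] is the essential supremum when the space has positive measure and 0
    otherwise; in the second case both sides hold, the left one because [c] is nonnegative. *)
Lemma Linfty_norm_leP u (c : \bar R) : (0 <= c)%E ->
  (Linfty_norm mu u <= c)%E <-> \forall x \ae mu, ((cabs (u x))%:E <= c)%E.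
Proof.
move=> c0; rewrite /Linfty_norm unlock/=; case: ifPn => [_|].
  have -> : abse \o (fun x => (cabs (u x))%:E) = fun x => (cabs (u x))%:E.
    by apply/funext => x /=; rewrite ger0_norm// cabs_ge0.
  by split=> /ess_supP.
rewrite -leNgt => muT0; split => // _; exists setT; split => //.
by apply/eqP; rewrite eq_le muT0 measure_ge0.
Qed.

Lemma Linfty_norm_ge0 u : (0 <= Linfty_norm mu u)%E.
Proof. exact: Lnorm_ge0. Qed.

End Linfty_norm_theory.

(** * Subsets of finite positive measure *)

Lemma sigma_finite_subset {d : measure_display} {T : measurableType d}
    {R : realType} (mu : {sigma_finite_measure set T -> \bar R}) (E : set T) :
  measurable E -> (0 < mu E)%E ->
  exists A, [/\ measurable A, A `<=` E & (0 < mu A < +oo)%E].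
Proof.
move=> mE E0; have [F FT mF] := sigma_finiteT mu.
(* Otherwise every piece [E]&[F k] of a countable cover by sets of finite measure is null, and hence
   so is [E]. *)
apply: contrapT => noA; have : mu.-negligible E.
  rewrite -[E]setIT FT setI_bigcupr; apply: negligible_bigcup => k.
  have [mFk Fky] := mF k; have mEF := measurableI _ _ mE mFk.
  exists (E `&` F k); split => //; apply: contrapT => /eqP EF0.
  apply: noA; exists (E `&` F k); split => //.
  rewrite lt0e EF0 measure_ge0/= (le_lt_trans _ Fky)//.
  by rewrite le_measure ?inE//; exact: subIsetr.
by move=> /(measure_negligible mE) E0'; move: E0; rewrite E0' ltxx.
Qed.

(** * Comparison of the operator norm with the essential supremum *)

Section multiplication_operator.
Context {d : measure_display} {T : measurableType d} {R : realType}.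
Variables (mu : {sigma_finite_measure set T -> \bar R}).
Variables (phi : R -> R) (w : T -> R).
Hypotheses (phi_orlicz : orlicz_function phi) (w_ge0 : forall x, 0 <= w x).
Hypotheses (w_loc : locally_integrable_fun mu w).
Hypotheses (w_gt0 : \forall x \ae mu, 0 < w x).
Implicit Type u : T -> R[i].

(** Finiteness is local integrability. A zero integral would force [w = 0] almost everywhere on [A],
    so that [A] would be null by [w_gt0]. *)
Lemma weight_integral_gt0 (A : set T) : measurable A -> (0 < mu A < +oo)%E ->
  (0 < \int[mu]_(x in A) (w x)%:E < +oo)%E.
Proof.
move=> mA /andP[A0 Ay]; case: (w_loc) => w_meas /(_ A mA Ay) int_w.
have absE : (\int[mu]_(x in A) (w x)%:E = \int[mu]_(x in A) `|(w x)%:E|)%E.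
  by apply: eq_integral => x _; rewrite gee0_abs// lee_fin.
apply/andP; split; last by rewrite absE; case/integrableP: int_w.
rewrite lt0e integral_ge0 ?andbT; last by move=> x _; rewrite lee_fin.
apply/eqP; rewrite absE => /ae_eq_integral_abs-/(_ mA).
have mw : measurable_fun A (EFin \o w).
  by apply/measurable_EFinP; exact: measurable_funTS.
move=> /(_ mw) w0; have : mu.-negligible A.
  have : \forall x \ae mu, ~ A x.
    apply: filterS2 w0 w_gt0 => x /[swap] wx0 /[swap] Ax /(_ Ax) [wx].
    by move: wx0; rewrite wx ltxx.
  by apply: negligibleS => x /= Ax; apply.
by move=> /(measure_negligible mA) A0'; move: A0; rewrite A0' ltxx.
Qed.

Lemma le_operator_norm (c : R) u : 0 < c -> cmeasurable u ->
  ~ (\forall x \ae mu, cabs (u x) <= c) ->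
  (c%:E <= operator_norm mu phi w (mult_operator u))%E.
Proof.
move=> c0 u_meas uc; have w_meas := w_loc.1.
pose E := (fun x => cabs (u x)) @^-1` `]c, +oo[.
have mE : measurable E.
  by rewrite -[E]setTI; apply: (measurable_cabs u_meas) => //; exact: measurable_itv.
have E0 : (0 < mu E)%E.
  rewrite lt0e measure_ge0 andbT; apply/eqP => E0; apply: uc.
  exists E; split => // x /= /negP; rewrite -ltNge => cux.
  by rewrite /E/= in_itv/= andbT.
have [A [mA AE Afin]] := sigma_finite_subset _ _ mE E0.
have wA := weight_integral_gt0 _ mA Afin.
have [a a0 f1] := orlicz_norm_indic1 mu _ _ phi_orlicz w_ge0 w_meas _ mA wA.
set f := fun x => _ in f1.
have fL : orlicz_space mu phi w f.
  by apply: orlicz_space_indic => //; [exact: ltW|case/andP: wA].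
apply: le_trans (operator_norm_ub _ _ _ u f fL _); last by rewrite f1.
have muf := cmeasurable_mult u_meas fL.1.
rewrite -[leLHS]mule1 -f1 -lee_pdivlMl//.
apply: orlicz_norm_le => //; [by rewrite invr_gt0|exact: fL.1|].
apply: aeW => x; rewrite cabsM ler_pdivlMl// /f cabs_real indicE.
have [xA|xA] := boolP (x \in A); last by rewrite mulr0 normr0 !mulr0.
rewrite ler_wpM2r//; move: xA => /set_mem/AE.
by rewrite /E/= in_itv/= andbT => /ltW.
Qed.

Lemma Linfty_norm_le_operator_norm u : cmeasurable u ->
  (Linfty_norm mu u <= operator_norm mu phi w (mult_operator u))%E.
Proof.
move=> u_meas; have w_meas := w_loc.1.
have := operator_norm_ge0 mu _ _ phi_orlicz w_ge0 w_meas u.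
have := le_operator_norm _ u ^~ u_meas.
case: (operator_norm _ _ _ _) => [r|_ _|//]; last by rewrite leey.
rewrite lee_fin => le_r r0; apply/lee_addgt0Pr => e e0; rewrite -EFinD.
(* The level must be positive and exceed the operator norm [r], which may be 0; were [|u| <= r + e]
   to fail, [le_operator_norm] would give [r + e <= r]. *)
have re0 : 0 < r + e by exact: ltr_wpDl.
apply/Linfty_norm_leP; first by rewrite lee_fin ltW.
apply: contrapT => /(le_r _ re0).
by rewrite lee_fin gerDl leNgt e0.
Qed.

Lemma operator_norm_le_Linfty_norm u : Linfty mu u ->
  (operator_norm mu phi w (mult_operator u) <= Linfty_norm mu u)%E.
Proof.
move=> [u_meas]; have w_meas := w_loc.1.
have := Linfty_norm_ge0 mu u; case uE : (Linfty_norm mu u) => [r||]//.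
rewrite lee_fin => r0 _; apply/lee_addgt0Pr => e e0; rewrite -EFinD.
have re0 : 0 < r + e by exact: ltr_wpDl.
apply: operator_norm_le => //; apply/(Linfty_norm_leP mu u (r + e)%:E).
  by rewrite lee_fin ltW.
by rewrite uE lee_fin lerDl ltW.
Qed.

Lemma Linfty_bounded_operator u : Linfty mu u ->
  bounded_operator mu phi w (mult_operator u).
Proof.
move=> [u_meas]; have w_meas := w_loc.1.
have := Linfty_norm_ge0 mu u; case uE : (Linfty_norm mu u) => [r||]//.
(* Adding 1 keeps the constant positive even when [u] vanishes almost everywhere. *)
rewrite lee_fin => r0 _; have r1 : 0 < r + 1 by exact: ltr_wpDl.
have ur : \forall x \ae mu, cabs (u x) <= r + 1.
  apply/(Linfty_norm_leP mu u (r + 1)%:E); first by rewrite lee_fin ltW.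
  by rewrite uE lee_fin lerDl.
have uf := mult_operator_le mu _ _ phi_orlicz w_ge0 w_meas _ u _ r1 u_meas ur.
split=> [f /uf[]//|]; exists (r + 1); first exact: ltW.
by move=> f /uf[].
Qed.

End multiplication_operator.

(** * Boundedness criterion and equality of the norms *)

Theorem theorem3p5 (R : realType) (d : measure_display)
    (T : measurableType d) (mu : {sigma_finite_measure set T -> \bar R})
    (mu_complete : measure_is_complete mu)
    (tau : T -> T) (tau_nonsingular : nonsingular mu tau)
    (w : T -> R) (w_RN : is_RN_pushforward mu tau w)
    (phi : R -> R) (phi_orlicz : orlicz_function phi)
    (norm_definite : orlicz_norm_definite mu phi w)
    (u : T -> R[i]) (u_meas : cmeasurable u) :
  (bounded_operator mu phi w (mult_operator u) <-> Linfty mu u) /\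
  (bounded_operator mu phi w (mult_operator u) ->
   operator_norm mu phi w (mult_operator u) = Linfty_norm mu u).
Proof.
case: w_RN => w_ge0 w_loc _.
have w_gt0 := weight_gt0_ae mu _ _ phi_orlicz w_ge0 w_loc.1 norm_definite.
have le_op := Linfty_norm_le_operator_norm mu _ _ phi_orlicz w_ge0 w_loc w_gt0
  u u_meas.
(* The inequality [le_op] is between extended reals, so finiteness of the operator norm passes to
   the essential supremum. *)
have bounded_Linfty : bounded_operator mu phi w (mult_operator u) -> Linfty mu u.
  by move=> /bounded_operator_norm; split=> //; exact: le_lt_trans le_op _.
split; first by split => // /Linfty_bounded_operator; exact.
move=> /bounded_Linfty uL; apply/eqP; rewrite eq_le le_op andbT.
exact: operator_norm_le_Linfty_norm.
Qed.
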